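(* Let $\mathcal{M}$ be a finite von Neumann algebra acting on a Hilbert space $\mathcal{H}$, and let $\mathfrak{A}\subseteq\mathcal{B}(\mathcal{H})$ be a transitive algebra which contains the commutant $\mathcal{M}'$. If $\mathfrak{A}$ is $2$-fold transitive, then $\mathfrak{A}$ is strongly dense in $\mathcal{B}(\mathcal{H})$.
   Context: $\mathcal{H}$ is a complex Hilbert space and $\mathcal{B}(\mathcal{H})$ the algebra of bounded operators on it. A subalgebra $\mathfrak{A}\subseteq\mathcal{B}(\mathcal{H})$ (not assumed self-adjoint or closed) is transitive if it contains the identity operator and has no invariant closed subspaces other than $\{0\}$ and $\mathcal{H}$. A transitive algebra $\mathfrak{A}$ is $2$-fold transitive if for any linearly independent vectors $\xi,\eta\in\mathcal{H}$ the norm closure of $\{(T\xi,T\eta): T\in\mathfrak{A}\}$ is $\mathcal{H}\oplus\mathcal{H}$. ''Strongly dense'' means dense in the strong operator topology. *)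

(* Defs.v *)
From mathcomp Require Import all_boot all_order all_algebra.
From mathcomp Require Import sesquilinear complex.
From mathcomp Require Import all_classical all_reals all_analysis.

Set Implicit Arguments.
Unset Strict Implicit.
Unset Printing Implicit Defensive.

Import Order.TTheory GRing.Theory Num.Theory.
Import numFieldNormedType.Exports.
Local Open Scope classical_set_scope.
Local Open Scope ring_scope.
Local Open Scope complex_scope.

(* An operator is represented by its underlying function H -> H, and an algebra
   of operators by a set of such functions contained in [bounded_operator]. *)

Section BanachSpace.
Variables (R : realType) (H : completeNormedModType R[i]).
Implicit Types (T S : H -> H) (A M : set (H -> H)) (V : set H).

(* A bound c is a complex number, but c * `|x| can only dominate the norm
   `|T x| if it is real, by definition of the order on R[i]. *)
Definition bounded_operator : set (H -> H) :=
  [set T | linear T /\ exists c : R[i], forall x, `|T x| <= c * `|x|].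

Definition subalgebra A : Prop :=
  [/\ A `<=` bounded_operator,
      A (fun=> 0),
      (forall S T, A S -> A T -> A (fun x => S x + T x)),
      (forall (a : R[i]) T, A T -> A (fun x => a *: T x)) &
      (forall S T, A S -> A T -> A (S \o T))].

Definition linear_subspace V : Prop :=
  [/\ V 0, (forall x y, V x -> V y -> V (x + y)) &
      (forall (a : R[i]) x, V x -> V (a *: x))].

Definition invariant A V : Prop := forall T x, A T -> V x -> V (T x).

Definition transitive_algebra A : Prop :=
  [/\ subalgebra A, A id &
      forall V, linear_subspace V -> closed V -> invariant A V ->
        V = [set 0] \/ V = setT].

Definition linearly_independent (x y : H) : Prop :=
  forall a b : R[i], a *: x + b *: y = 0 -> a = 0 /\ b = 0.

(* H * H carries the product topology, which is that of the norm of the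
   Hilbert sum of two copies of H. *)
Definition two_fold_transitive A : Prop :=
  forall x y, linearly_independent x y ->
    closure [set ((T x, T y) : H * H) | T in A] = setT.

(* The strong operator topology is the topology of pointwise norm convergence,
   restricted to the bounded operators. *)
Definition strongly_dense A : Prop :=
  bounded_operator `<=` closure (A : set {ptws H -> H}).

Definition commutant M : set (H -> H) :=
  [set T | bounded_operator T /\ forall S, M S -> T \o S = S \o T].

End BanachSpace.

Section HilbertSpace.
Variables (R : realType) (H : completeNormedModType R[i]).
Variable dot : {dot H for (@Num.conj R[i])}.
Implicit Types (T S P Q : H -> H) (M : set (H -> H)).

Definition dot_induces_norm : Prop := forall x : H, `|x| ^+ 2 = dot x x.

Definition adjoint T S : Prop := forall x y, dot (T x) y = dot x (S y).

Definition von_neumann_algebra M : Prop :=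
  [/\ subalgebra M,
      (forall T, M T -> exists2 S, M S & adjoint T S) &
      commutant (commutant M) = M].

Definition projection P : Prop :=
  [/\ bounded_operator P, P \o P = P & adjoint P P].

Definition projection_le P Q : Prop := Q \o P = P.

(* Murray-von Neumann equivalence relative to M *)
Definition equivalent_in M P Q : Prop :=
  exists U Us, [/\ M U, M Us, adjoint U Us, Us \o U = P & U \o Us = Q].

Definition finite_projection M P : Prop :=
  [/\ M P, projection P &
      forall Q, M Q -> projection Q -> projection_le Q P ->
        equivalent_in M P Q -> Q = P].

Definition finite_von_neumann_algebra M : Prop :=
  von_neumann_algebra M /\ finite_projection M id.

End HilbertSpace.

(* Main.v *)
(** Let [X] be a linearly independent family of [n + 1 >= 2] vectors and [K] the
    closure of [{(T X_i)_i : T in A}] in [H^(n+1)], with [A] already known to be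
    [n]-fold transitive; the goal is that the annihilator [W] of [K] vanishes.
    By [n]-fold transitivity, an element of [W] two of whose coordinates are
    proportional is zero, so the last coordinate is injective on [W]. Let [q]
    project [H^(n+1)] onto [W]; it commutes with [M'], hence so does the map
    [phi (x, y) = (q (x e_0 + y e_n))_n] from [H^2] to [H]. If [phi] were
    injective, the isometric factor [(U_1, U_2)] of its polar decomposition
    would consist of isometries of [M'' = M] with orthogonal ranges; as [M] is
    finite, [U_1] would be onto and [U_2 = 0]. So [phi (x, y) = 0] for some
    [(x, y) <> 0], that is, [q (x e_0 + y e_n) = 0] and [x e_0 + y e_n] lies in
    [K]. If [x] and [y] are independent, 2-fold transitivity forces
    [w_0 = w_n = 0] for [w] in [W]; otherwise transitivity makes [w_0] and [w_n]
    proportional. In both cases [W = 0]. *)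

Require Import Defs.
From HB Require Import structures.
From mathcomp Require Import all_boot all_order all_algebra.
From mathcomp Require Import sesquilinear complex.
From mathcomp Require Import all_classical all_reals all_analysis.
From mathcomp Require Import lra ring.
Import Order.TTheory GRing.Theory Num.Theory.
Import numFieldNormedType.Exports.
Local Open Scope classical_set_scope.
Local Open Scope ring_scope.
Local Open Scope complex_scope.

Set Implicit Arguments.
Unset Strict Implicit.
Unset Printing Implicit Defensive.

Import Normc.
Local Notation Re := complex.Re.

(** * Norm of an inner product *)

Lemma ReD (R : realType) (a b : R[i]) : Re (a + b) = Re a + Re b.
Proof. by case: a b => [a1 a2] [b1 b2]; reflexivity. Qed.

Lemma ReN (R : realType) (a : R[i]) : Re (- a) = - Re a.
Proof. by case: a. Qed.

Lemma conjcE (R : realType) (a : R[i]) : Num.conj a = conjc a.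
Proof. by []. Qed.

Lemma normr_normc (R : realType) (a : R[i]) : `|a| = (normc a)%:C.
Proof. by []. Qed.

Lemma normc_ge0 (R : realType) (a : R[i]) : 0 <= normc a.
Proof. by case: a => x y; apply: sqrtr_ge0. Qed.

Lemma normc_real (R : realType) (x : R) : normc x%:C = `|x|.
Proof. by rewrite /normc /= expr0n addr0 sqrtr_sqr. Qed.

Lemma sqr_normcE (R : realType) (x y : R) :
  normc (x +i* y) ^+ 2 = x ^+ 2 + y ^+ 2.
Proof. by rewrite /normc sqr_sqrtr // addr_ge0 ?sqr_ge0. Qed.

(** This is the cross term that arises on subtracting the component along a vector of squared norm
    [n]. *)
Lemma Re_conjc_div (R : realType) (c : R[i]) (n : R) :
  Re (conjc (c / n%:C) * c) = normc c ^+ 2 / n.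
Proof.
rewrite -fmorphV; case: c => x y; rewrite sqr_normcE /=; ring.
Qed.

Lemma gt0_real_complex (R : realType) (c : R[i]) :
  0 < c -> exists2 e : R, 0 < e & c = e%:C.
Proof.
by case: c => a b; rewrite ltcE /= => /andP[/eqP-> a0]; exists a.
Qed.

Section HilbertNorm.
Variables (R : realType) (V : lmodType R[i]) (f : {dot V for (@Num.conj R[i])}).
Implicit Types (u v w : V) (a : R[i]).

(** Built from the form alone, so that it serves [H] and its finite direct sums alike. It takes
    values in [R], where the order is total, rather than in [R[i]]. *)
Definition hnorm v : R := Num.sqrt (Re (f v v)).

Lemma hnorm_ge0 v : 0 <= hnorm v.
Proof. exact: sqrtr_ge0. Qed.

Lemma sqr_hnorm v : hnorm v ^+ 2 = Re (f v v).
Proof.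
rewrite sqr_sqrtr //; have := dnorm_ge0 f v.
by rewrite lecE => /andP[_].
Qed.

Lemma dot_hnorm v : f v v = (hnorm v ^+ 2)%:C.
Proof.
rewrite sqr_hnorm; apply/esym/RRe_real/ger0_real; exact: dnorm_ge0.
Qed.

Lemma dotC u v : f u v = Num.conj (f v u).
Proof. by rewrite hermC expr0 mul1r. Qed.

Lemma dotDl u v w : f (u + v) w = f u w + f v w.
Proof. exact: linearDl. Qed.

Lemma dotDr u v w : f u (v + w) = f u v + f u w.
Proof. exact: linearDr. Qed.

Lemma dotBl u v w : f (u - v) w = f u w - f v w.
Proof. exact: linearBl. Qed.

Lemma dotBr u v w : f u (v - w) = f u v - f u w.
Proof. exact: linearBr. Qed.

Lemma dotZl a u v : f (a *: u) v = a * f u v.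
Proof. exact: linearZl_LR. Qed.

Lemma dotZr a u v : f u (a *: v) = Num.conj a * f u v.
Proof. exact: linearZr_LR. Qed.

Lemma dot0l u : f 0 u = 0.
Proof. exact: linear0l. Qed.

Lemma dot0r u : f u 0 = 0.
Proof. exact: linear0r. Qed.

Lemma hnorm0 : hnorm 0 = 0.
Proof. by rewrite /hnorm linear0r sqrtr0. Qed.

Lemma hnorm_eq0 v : hnorm v = 0 -> v = 0.
Proof.
move=> v0; apply/eqP; rewrite -(dnorm_eq0 f) dot_hnorm v0 expr0n /=.
by rewrite eqxx.
Qed.

Lemma hnormZ a v : hnorm (a *: v) = normc a * hnorm v.
Proof.
apply/eqP; rewrite -(@eqrXn2 _ 2) ?hnorm_ge0 ?mulr_ge0 ?normc_ge0 ?hnorm_ge0 //.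
apply/eqP/complexI; rewrite -dot_hnorm dnormZ dot_hnorm exprMn normr_normc.
by rewrite [RHS]rmorphM !(rmorphXn (real_complex R)).
Qed.

Lemma sqr_hnormD u v :
  hnorm (u + v) ^+ 2 = hnorm u ^+ 2 + hnorm v ^+ 2 + 2 * Re (f u v).
Proof.
rewrite !sqr_hnorm dnormD !ReD conjcE; congr (_ + _).
by case: (f u v) => x y /=; rewrite mulr2n mulrDl mul1r.
Qed.

Lemma sqr_hnormB u v :
  hnorm (u - v) ^+ 2 = hnorm u ^+ 2 + hnorm v ^+ 2 - 2 * Re (f u v).
Proof.
rewrite sqr_hnormD linearNr ReN mulrN; congr (_ + _ ^+ 2 - _).
by rewrite /hnorm linearNr linearNl opprK.
Qed.

Lemma hnorm_opp v : hnorm (- v) = hnorm v.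
Proof. by rewrite /hnorm linearNr linearNl opprK. Qed.

Lemma hnormBC u v : hnorm (u - v) = hnorm (v - u).
Proof. by rewrite -hnorm_opp opprB. Qed.

(** Subtracting from [u] its component along [v] leaves a vector of squared norm
    [|u|^2 - |f u v|^2 / |v|^2], which is nonnegative. *)
Lemma dot_CauchySchwarz u v : normc (f u v) <= hnorm u * hnorm v.
Proof.
have [->|v0] := eqVneq v 0.
  by rewrite linear0r normc0 hnorm0 mulr0.
have nv0 : 0 < hnorm v ^+ 2 by rewrite -ltcR -dot_hnorm dnorm_gt0.
rewrite -ler_sqr ?nnegrE ?normc_ge0 ?mulr_ge0 ?hnorm_ge0 // exprMn.
rewrite -ler_pdivrMr //.
have := exprn_ge0 2 (hnorm_ge0 (u - (f u v / f v v) *: v)).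
rewrite sqr_hnormB hnormZ linearZr_LR /= dot_hnorm conjcE.
rewrite Re_conjc_div.
rewrite normcM normcV normc_real (ger0_norm (ltW nv0)).
have h0 : hnorm v != 0 by apply: contraTneq nv0 => ->; rewrite expr0n ltxx.
have -> : (normc (f u v) * (hnorm v ^+ 2)^-1 * hnorm v) ^+ 2 =
  normc (f u v) ^+ 2 / hnorm v ^+ 2 by field.
lra.
Qed.

Lemma normc_ge_abs_Re a : `|Re a| <= normc a.
Proof. by rewrite -lecR -normr_normc; apply: normc_ge_Re. Qed.

Lemma hnorm_leD u v : hnorm (u + v) <= hnorm u + hnorm v.
Proof.
rewrite -ler_sqr ?nnegrE ?addr_ge0 ?hnorm_ge0 // sqr_hnormD sqrrD.
have := le_trans (ler_norm _) (le_trans (normc_ge_abs_Re _)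
  (dot_CauchySchwarz u v)).
lra.
Qed.

Lemma hnormB_le u v w : hnorm (u - w) <= hnorm (u - v) + hnorm (v - w).
Proof. by apply: le_trans (hnorm_leD _ _); rewrite addrA subrK. Qed.

Lemma parallelogram u v :
  hnorm (u + v) ^+ 2 + hnorm (u - v) ^+ 2 =
  2 * hnorm u ^+ 2 + 2 * hnorm v ^+ 2.
Proof. by rewrite sqr_hnormD sqr_hnormB; ring. Qed.

Lemma hnorm_sum (I : finType) (F : I -> V) :
  hnorm (\sum_i F i) <= \sum_i hnorm (F i).
Proof.
elim/big_ind2: _ => [|x1 x2 y1 y2 h1 h2|//]; first by rewrite hnorm0.
by apply: le_trans (hnorm_leD _ _) _; apply: lerD.
Qed.

Lemma hnorm_lt_eq0 v : (forall e, 0 < e -> hnorm v <= e) -> v = 0.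
Proof.
move=> h; apply: hnorm_eq0; apply/eqP; rewrite eq_le hnorm_ge0 andbT.
by apply/ler_addgt0Pl => e e0; rewrite addr0; apply: h.
Qed.

Lemma dot_ext u v : (forall w, f w u = f w v) -> u = v.
Proof.
move=> h; apply/eqP; rewrite -subr_eq0 -(dnorm_eq0 f) dotBr h.
by rewrite subrr.
Qed.

(** [V] carries no topology, so convergence, completeness and closedness are phrased directly with
    [hnorm]. *)
Definition hlim (x : nat -> V) (l : V) : Prop :=
  forall e : R, 0 < e -> exists N, forall n, (N <= n)%N -> hnorm (x n - l) < e.

Definition hcauchy (x : nat -> V) : Prop :=
  forall e : R, 0 < e ->
    exists N, forall m n, (N <= m)%N -> (N <= n)%N -> hnorm (x m - x n) < e.

Definition hcomplete : Prop := forall x, hcauchy x -> exists l, hlim x l.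

Definition hclosed (K : set V) : Prop :=
  forall v, (forall e : R, 0 < e -> exists2 k, K k & hnorm (v - k) < e) -> K v.

Definition hsubspace (K : set V) : Prop :=
  [/\ K 0, forall u v, K u -> K v -> K (u + v) &
      forall a u, K u -> K (a *: u)].

Lemma hsubspaceB K u v : hsubspace K -> K u -> K v -> K (u - v).
Proof.
by case=> _ D Z Ku Kv; apply: D => //; rewrite -scaleN1r; apply: Z.
Qed.

End HilbertNorm.

(** * Orthogonal projections and adjoints *)

Lemma invSn_lt (R : realType) (e : R) :
  0 < e -> exists N, forall n, (N <= n)%N -> n.+1%:R^-1 < e.
Proof.
move=> e0; exists (Num.bound e^-1) => n Nn.
rewrite invf_plt ?posrE ?ltr0n //.
have := archi_boundP (ltW (_ : 0 < e^-1)); rewrite invr_gt0 => /(_ e0) h.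
by apply: (lt_le_trans h); rewrite ler_nat; apply: leqW.
Qed.

Section HilbertSpace.
Variables (R : realType) (V : lmodType R[i]) (f : {dot V for (@Num.conj R[i])}).
Implicit Types (u v w : V) (a : R[i]).

Lemma hlim_le (x : nat -> V) l w (c : R) N :
  hlim f x l -> (forall n, (N <= n)%N -> hnorm f (x n - w) <= c) ->
  hnorm f (l - w) <= c.
Proof.
move=> xl xc; apply/ler_addgt0Pl => e e0.
have [M hM] := xl e e0.
apply: le_trans (hnormB_le f _ (x (maxn M N)) _) _.
apply: lerD; last by apply: xc; rewrite leq_maxr.
by rewrite hnormBC; apply/ltW/hM; rewrite leq_maxl.
Qed.

(** At [a = f u w / f w w] the squared norm of [u - a *: w] drops by [|f u w|^2 / |w|^2], so
    minimality makes this quantity vanish. *)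
Lemma orthogonal_of_minimal u w :
  (forall a, hnorm f u <= hnorm f (u - a *: w)) -> f u w = 0.
Proof.
move=> h; have [->|w0] := eqVneq w 0; first by rewrite dot0r.
have nw0 : 0 < hnorm f w ^+ 2 by rewrite -ltcR -dot_hnorm dnorm_gt0.
have := h (f u w / f w w).
rewrite -ler_sqr ?nnegrE ?hnorm_ge0 // sqr_hnormB hnormZ dotZr dot_hnorm conjcE.
rewrite Re_conjc_div normcM normcV normc_real (ger0_norm (ltW nw0)).
have h0 : hnorm f w != 0 by apply: contraTneq nw0 => ->; rewrite expr0n ltxx.
have -> : (normc (f u w) * (hnorm f w ^+ 2)^-1 * hnorm f w) ^+ 2 =
  normc (f u w) ^+ 2 / hnorm f w ^+ 2 by field.
move=> h1; have {h1} : normc (f u w) ^+ 2 / hnorm f w ^+ 2 <= 0 by lra.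
rewrite ler_pdivrMr // mul0r => h1; apply: eq0_normc; apply/eqP.
by rewrite -sqrf_eq0 eq_le h1 sqr_ge0.
Qed.

(** A minimising sequence is Cauchy by the parallelogram law, since midpoints stay in [K]; its limit
    is the nearest point, and minimality gives orthogonality. *)
Lemma orthogonal_projection (K : set V) v :
  hcomplete f -> hsubspace K -> hclosed f K ->
  exists2 p, K p & forall k, K k -> f (v - p) k = 0.
Proof.
move=> cV sK clK; have [K0 KD KZ] := sK.
pose S := [set hnorm f (v - k) ^+ 2 | k in K].
have hS : has_inf S.
  split; first by exists (hnorm f (v - 0) ^+ 2), 0.
  by exists 0 => _ [k _ <-]; apply: sqr_ge0.
have le_d k : K k -> inf S <= hnorm f (v - k) ^+ 2.
  by move=> Kk; apply: ge_inf; [exact: hS.2|exists k].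
have /choice[x hx] n : exists k, K k /\ hnorm f (v - k) ^+ 2 < inf S + n.+1%:R^-1.
  have [|_ [k Kk <-] hk] := @inf_adherent _ S n.+1%:R^-1 _ hS.
    by rewrite invr_gt0 ltr0n.
  by exists k.
have [p xp] : exists p, hlim f x p.
  apply: cV => e e0.
  (* The midpoint is at squared distance at least [inf S], so the squared norm of [x m - x n] is at
     most [2 * (m.+1%:R^-1 + n.+1%:R^-1)], which is below [e ^+ 2]. *)
  have [|N hN] := @invSn_lt R (e ^+ 2 / 4); first by rewrite divr_gt0 ?exprn_gt0.
  exists N => m n Nm Nn.
  have [[Km hm] [Kn hn]] := (hx m, hx n).
  have := parallelogram f (v - x m) (v - x n).
  have -> : v - x m - (v - x n) = x n - x m by rewrite opprB addrC subrKA.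
  have -> : v - x m + (v - x n) = 2 *: (v - 2^-1 *: (x m + x n)).
    rewrite scalerBr scalerA divff ?pnatr_eq0 // scale1r scaler_nat mulr2n.
    by rewrite addrACA -opprD.
  rewrite hnormZ exprMn (_ : normc 2 = 2); last first.
    by rewrite -[2](rmorph_nat (real_complex R)) normc_real ger0_norm.
  have := le_d _ (KZ 2^-1 _ (KD _ _ Km Kn)).
  move=> h1 h2; rewrite hnormBC -ltr_sqr ?nnegrE ?hnorm_ge0 ?ltW //.
  move: (hN m Nm) (hN n Nn) hm hn.
  move: (m.+1%:R^-1) (n.+1%:R^-1) => b c; lra.
have Kp : K p.
  apply: clK => e e0; have [N hN] := xp e e0; exists (x N); first exact: (hx N).1.
  by rewrite hnormBC; apply: hN.
exists p => // k Kk; apply: orthogonal_of_minimal => a.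
rewrite -addrA -opprD.
rewrite -ler_sqr ?nnegrE ?hnorm_ge0 //.
apply: le_trans (le_d _ (KD _ _ Kp (KZ a _ Kk))).
(* The minimal distance passes to the limit, because [inf S + e ^+ 2] is at most the square of
   [e + Num.sqrt (inf S)]. *)
have : hnorm f (p - v) <= Num.sqrt (inf S).
  apply/ler_addgt0Pl => e e0.
  have [N hN] := invSn_lt (exprn_gt0 2 e0).
  apply: (@hlim_le x _ _ _ N) => // n Nn; rewrite hnormBC.
  have e1 : 0 <= e + Num.sqrt (inf S) by rewrite addr_ge0 ?sqrtr_ge0 ?ltW.
  rewrite -ler_sqr ?nnegrE ?hnorm_ge0 //.
  have iS : 0 <= inf S.
    by apply: lb_le_inf; [exact: hS.1|move=> _ [j _ <-]; apply: sqr_ge0].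
  rewrite sqrrD (sqr_sqrtr iS); move: (hx n).2 (hN n Nn); move: (n.+1%:R^-1) => b.
  have : 0 <= e * Num.sqrt (inf S) by rewrite mulr_ge0 ?sqrtr_ge0 ?ltW.
  lra.
rewrite hnormBC => h; rewrite -[leRHS]sqr_sqrtr; last first.
  by apply: lb_le_inf; [exact: hS.1|move=> _ [j _ <-]; apply: sqr_ge0].
by rewrite ler_sqr ?nnegrE ?hnorm_ge0 ?sqrtr_ge0.
Qed.

End HilbertSpace.

Lemma le0_of_eps (R : realType) (a c : R) :
  0 <= c -> (forall e, 0 < e -> a <= c * e) -> a <= 0.
Proof.
move=> c0 h; apply/ler_addgt0Pl => e e0; rewrite addr0.
have c1 : 0 < c + 1 by rewrite ltr_wpDl.
have := h (e / (c + 1)) (divr_gt0 e0 c1).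
have : c * (e / (c + 1)) <= e.
  rewrite mulrA ler_pdivrMr //; nra.
lra.
Qed.

Section Linear.
Variables (K : nzRingType) (V W : lmodType K) (T : V -> W).
Hypothesis linT : linear T.

Lemma lin_D u v : T (u + v) = T u + T v.
Proof. by rewrite -[u in LHS]scale1r linT scale1r. Qed.

Lemma lin_0 : T 0 = 0.
Proof. by apply: (addIr (T 0)); rewrite add0r -lin_D addr0. Qed.

Lemma lin_Z a u : T (a *: u) = a *: T u.
Proof. by rewrite -[in LHS](addr0 (a *: u)) linT lin_0 addr0. Qed.

Lemma lin_N u : T (- u) = - T u.
Proof. by rewrite -scaleN1r lin_Z scaleN1r. Qed.

Lemma lin_B u v : T (u - v) = T u - T v.
Proof. by rewrite lin_D lin_N. Qed.

Lemma lin_sum (I : finType) (F : I -> V) : T (\sum_i F i) = \sum_i T (F i).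
Proof. exact: (big_morph T lin_D lin_0). Qed.

End Linear.

Section HilbertSpace.
Variables (R : realType) (V : lmodType R[i]) (f : {dot V for (@Num.conj R[i])}).
Implicit Types (u v w : V) (a : R[i]) (x y : nat -> V).

Lemma hlim_uniq x u v : hlim f x u -> hlim f x v -> u = v.
Proof.
move=> xu xv; apply/eqP; rewrite -subr_eq0; apply/eqP.
apply: (@hnorm_lt_eq0 _ _ f) => e e0.
have [N hN] := xv e e0; apply: (hlim_le (N := N) xu) => n Nn; exact/ltW/hN.
Qed.

Lemma hlimD x y u v : hlim f x u -> hlim f y v ->
  hlim f (fun n => x n + y n) (u + v).
Proof.
move=> xu yv e e0; have e2 : 0 < e / 2 by rewrite divr_gt0.
have [[M hM] [N hN]] := (xu _ e2, yv _ e2).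
exists (maxn M N) => n; rewrite geq_max => /andP[/hM h1 /hN h2].
rewrite opprD addrACA; apply: (le_lt_trans (hnorm_leD f _ _)). lra.
Qed.

Lemma hlim_cst u : hlim f (fun=> u) u.
Proof. by move=> e e0; exists 0%N => n _; rewrite subrr hnorm0. Qed.

Lemma hlim_shift x u : hlim f x u -> hlim f (fun n => x n.+1) u.
Proof.
by move=> xu e /xu[N hN]; exists N => n Nn; apply: hN; apply: leqW.
Qed.

End HilbertSpace.

(** * Bounded maps, Riesz representation and adjoints *)

Section Bounded.
Variables (R : realType) (V W : lmodType R[i]).
Variables (f : {dot V for (@Num.conj R[i])}) (g : {dot W for (@Num.conj R[i])}).

Definition hbounded (T : V -> W) : Prop :=
  exists2 c : R, 0 <= c & forall v, hnorm g (T v) <= c * hnorm f v.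

Lemma hlim_bounded (T : V -> W) x l : linear T -> hbounded T ->
  hlim f x l -> hlim g (T \o x) (T l).
Proof.
move=> linT [c c0 hc] xl e e0.
have c1 : 0 < c + 1 by rewrite ltr_wpDl.
have [N hN] := xl _ (divr_gt0 e0 c1); exists N => n /hN h /=.
rewrite -lin_B //; apply: le_lt_trans (hc _) _.
move: h; rewrite ltr_pdivlMr //; have := hnorm_ge0 f (x n - l); nra.
Qed.

(** If [phi v <> 0], the component [u] of [v] orthogonal to the kernel spans the complement of the
    kernel: every [w] minus [(phi w / phi u) *: u] lies in the kernel. A multiple of [u] therefore
    represents [phi]. *)
Lemma Riesz_representation (phi : V -> R[i]) (c : R) :
  hcomplete f -> (forall a u v, phi (a *: u + v) = a * phi u + phi v) ->
  0 <= c -> (forall v, normc (phi v) <= c * hnorm f v) ->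
  exists z, forall v, phi v = f v z.
Proof.
move=> cV linphi c0 hc.
have phi0 : phi 0 = 0.
  by have := linphi (-1) 0 0; rewrite scaler0 addr0 mulN1r addNr.
have phiB u v : phi (u - v) = phi u - phi v.
  by rewrite addrC -scaleN1r linphi mulN1r addrC.
have [allz|/asboolPn/existsp_asboolPn[v phiv]] :=
  pselect (forall v, phi v = 0).
  by exists 0 => v; rewrite dot0r allz.
pose K := [set k | phi k = 0].
have sK : hsubspace K.
  split=> //.
    by move=> u w; rewrite /K /= => hu hw; rewrite -[u]scale1r linphi hu hw mulr0 addr0.
  by move=> a u; rewrite /K /= => hu; rewrite -[a *: u]addr0 linphi hu phi0 mulr0 addr0.
have clK : hclosed f K.
  move=> u hu; apply: eq0_normc; apply/eqP; rewrite eq_le normc_ge0 andbT.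
  apply: (le0_of_eps c0) => e /hu[k Kk hk].
  rewrite -[phi u]subr0 -Kk -phiB; apply: le_trans (hc _) _.
  by apply: ler_wpM2l => //; apply: ltW.
have [p Kp hp] := orthogonal_projection v cV sK clK.
pose u := v - p.
have phiu : phi u = phi v by rewrite phiB Kp subr0.
have u0 : u != 0 by apply/eqP => u0; apply: phiv; rewrite -phiu u0.
have fu0 : f u u != 0 by rewrite dnorm_eq0.
have phiu0 : phi u != 0 by rewrite phiu; apply/eqP.
exists (Num.conj (phi u / f u u) *: u) => w.
rewrite dotZr conjCK.
have Kw : K (- (phi w / phi u) *: u + w).
  by rewrite /K /= linphi mulNr divfK // addNr.
have := hp _ Kw; rewrite dotDr dotZr => /eqP.
rewrite addrC addr_eq0 -mulNr -/u => /eqP h.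
rewrite (dotC f w) h rmorphM !rmorphN opprK /= conjCK -(dotC f u u); field.
by rewrite fu0 phiu0.
Qed.

Lemma adjoint_exists (T : V -> W) : hcomplete f -> linear T -> hbounded T ->
  exists S : W -> V, forall v w, g (T v) w = f v (S w).
Proof.
move=> cV linT [c c0 hc].
have /choice[S hS] w : exists z, forall v, g (T v) w = f v z.
  apply: (@Riesz_representation _ (c * hnorm g w)) => //.
  - by move=> a u v; rewrite linT dotDl dotZl.
  - by rewrite mulr_ge0 ?hnorm_ge0.
  - move=> v; apply: le_trans (dot_CauchySchwarz _ _ _) _.
    by rewrite mulrAC ler_wpM2r ?hnorm_ge0.
by exists S.
Qed.

End Bounded.

Section AdjointLinear.
Variables (R : realType) (V W : lmodType R[i]).
Variables (f : {dot V for (@Num.conj R[i])}) (g : {dot W for (@Num.conj R[i])}).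
Variables (T : V -> W) (S : W -> V).
Hypothesis TS : forall v w, g (T v) w = f v (S w).

Lemma adjoint_linear : linear S.
Proof.
move=> a u v; apply: (dot_ext (f := f)) => w.
by rewrite -TS !dotDr !dotZr !TS.
Qed.

Lemma adjoint_sym v w : f (S w) v = g w (T v).
Proof. by rewrite dotC -TS -dotC. Qed.

(** The square of the norm of [S w] is the real part of [g w (T (S w))]; Cauchy-Schwarz bounds it,
    and one factor is cancelled. *)
Lemma adjoint_bound (c : R) : (forall v, hnorm g (T v) <= c * hnorm f v) ->
  0 <= c -> forall w, hnorm f (S w) <= c * hnorm g w.
Proof.
move=> hc c0 w.
have [->|Sw0] := eqVneq (hnorm f (S w)) 0; first by rewrite mulr_ge0 ?hnorm_ge0.
have Sw1 : 0 < hnorm f (S w) by rewrite lt_def Sw0 hnorm_ge0.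
rewrite -(ler_pM2r Sw1) -expr2 sqr_hnorm adjoint_sym.
apply: le_trans (ler_norm _) (le_trans (normc_ge_abs_Re _) _).
apply: le_trans (dot_CauchySchwarz _ _ _) _.
rewrite [leRHS]mulrAC [leRHS]mulrC; apply: ler_wpM2l; first exact: hnorm_ge0.
exact: hc.
Qed.

Lemma adjoint_hbounded : hbounded f g T -> hbounded g f S.
Proof. by case=> c c0 hc; exists c => // w; apply: adjoint_bound. Qed.

End AdjointLinear.

(** * Square roots and polar decomposition *)

Section ScalarIteration.
Variable R : realType.

(** The scalar iteration for [2 y = 1 + y^2], started at 0 and increasing within [0, 1]. *)
Fixpoint sqrt_majorant (n : nat) : R :=
  if n is m.+1 then (1 + sqrt_majorant m ^+ 2) / 2 else 0.

Lemma sqrt_majorant_bounds n :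
  [/\ 0 <= sqrt_majorant n, sqrt_majorant n <= 1 &
      sqrt_majorant n <= sqrt_majorant n.+1].
Proof.
elim: n => [|n [h0 h1 h2]]; first by split=> //=; lra.
by split=> /=; move: h2 => /=; nra.
Qed.

Lemma sqrt_majorant_cauchy (e : R) : 0 < e ->
  exists N, forall n, (N <= n)%N -> sqrt_majorant n - sqrt_majorant N < e.
Proof.
move=> e0.
have hS : has_sup (range sqrt_majorant).
  split; first by exists (sqrt_majorant 0), 0%N.
  by exists 1 => _ [n _ <-]; have [] := sqrt_majorant_bounds n.
(* An index whose value is within [e] of the supremum serves. *)
have [_ [N _ <-] hN] := sup_adherent e0 hS.
exists N => n _.
have : sqrt_majorant n <= sup (range sqrt_majorant).
  by apply: sup_upper_bound => //; exists n.
lra.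
Qed.

End ScalarIteration.

Section PositiveSquareRoot.
Variables (R : realType) (V : lmodType R[i]) (f : {dot V for (@Num.conj R[i])}).
Variable D : V -> V.
Hypotheses (cV : hcomplete f) (linD : linear D).
Hypotheses (leD : forall v, hnorm f (D v) <= hnorm f v).
Hypothesis (symD : forall u v, f (D u) v = f u (D v)).

(* The solution y of 2 y = D + y^2, so that (1 - y)^2 = 1 - D; the norms of the
   increments are dominated by those of the same iteration for D = 1. *)
Fixpoint sqrt_iter (n : nat) (v : V) : V :=
  if n is m.+1 then (2^-1 : R[i]) *: (D v + sqrt_iter m (sqrt_iter m v)) else 0.

Lemma hnorm_half (v : V) : hnorm f ((2^-1 : R[i]) *: v) = hnorm f v / 2.
Proof.
rewrite hnormZ mulrC normcV; congr (_ * _^-1).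
by rewrite -[2](rmorph_nat (real_complex R)) normc_real ger0_norm.
Qed.

Lemma sqrt_iter_linear n : linear (sqrt_iter n).
Proof.
elim: n => [|n IH] a u v /=; first by rewrite scaler0 addr0.
by rewrite linD !IH scalerA mulrC -scalerA -scalerDr addrACA -scalerDr.
Qed.

Lemma hnorm_sqrt_iter n v :
  hnorm f (sqrt_iter n v) <= sqrt_majorant R n * hnorm f v.
Proof.
elim: n v => [|n IH] v /=; first by rewrite hnorm0 mul0r.
rewrite hnorm_half; have := hnorm_leD f (D v) (sqrt_iter n (sqrt_iter n v)).
have := IH (sqrt_iter n v); have := IH v; have := leD v.
have [r0 _ _] := sqrt_majorant_bounds R n.
move: (hnorm f (sqrt_iter n v)) => a hD ha h1 h2.
have : sqrt_majorant R n * a <= sqrt_majorant R n ^+ 2 * hnorm f v.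
  by rewrite expr2 -mulrA; apply: ler_wpM2l.
lra.
Qed.

(** With [y] and [x] the iterates of ranks [n.+1] and [n], the next increment is half of
    [y (y - x) + (y - x) x]. The bounds on the factors add up to half the difference of the squared
    majorants, which is the next scalar increment. *)
Lemma hnorm_sqrt_iterS n v :
  hnorm f (sqrt_iter n.+1 v - sqrt_iter n v) <=
  (sqrt_majorant R n.+1 - sqrt_majorant R n) * hnorm f v.
Proof.
elim: n v => [|n IH] v.
  rewrite /= addr0 subr0 hnorm_half expr0n addr0 mul1r subr0.
  by have := leD v; lra.
have [r0 _ rS] := sqrt_majorant_bounds R n.
set x := sqrt_iter n; set y := sqrt_iter n.+1 in IH *.
have liny : linear y := sqrt_iter_linear n.+1.
have -> : sqrt_iter n.+2 v - y v = (2^-1 : R[i]) *: (y (y v - x v) + (y (x v) - x (x v))).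
  rewrite [in LHS]/= -/y [X in _ - X]/= -/x -scalerBr; congr (_ *: _).
  by rewrite opprD addrACA subrr add0r (lin_B liny) subrKA.
rewrite hnorm_half.
have h1 := hnorm_sqrt_iter n.+1 (y v - x v).
have h2 := hnorm_sqrt_iter n v.
have h3 := IH v; have h4 := IH (x v).
have h5 := hnorm_leD f (y (y v - x v)) (y (x v) - x (x v)).
have -> : sqrt_majorant R n.+2 - sqrt_majorant R n.+1 =
   (sqrt_majorant R n.+1 ^+ 2 - sqrt_majorant R n ^+ 2) / 2 by rewrite /=; field.
move: h1 h2 h3 h4 h5 rS; rewrite -/x -/y.
move: (sqrt_majorant R n.+1) => s.
move: (hnorm f (y (y v - x v))) (hnorm f (y v - x v)) (hnorm f (x v))
  (hnorm f (y (x v) - x (x v))) (hnorm f (y (y v - x v) + (y (x v) - x (x v)))).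
move: (sqrt_majorant R n) r0 (hnorm f v) => r r0 N A B C E F h1 h2 h3 h4 h5 rS.
have : s * B <= s * ((s - r) * N) by apply: ler_wpM2l => //; lra.
have : (s - r) * C <= (s - r) * (r * N) by apply: ler_wpM2l => //; lra.
lra.
Qed.

Lemma hnorm_sqrt_iterB n k v :
  hnorm f (sqrt_iter (n + k) v - sqrt_iter n v) <=
  (sqrt_majorant R (n + k) - sqrt_majorant R n) * hnorm f v.
Proof.
elim: k => [|k IH]; first by rewrite addn0 !subrr hnorm0 mul0r.
rewrite addnS; apply: le_trans (hnormB_le f _ (sqrt_iter (n + k) v) _) _.
have := hnorm_sqrt_iterS (n + k) v; lra.
Qed.

Lemma sqrt_iter_sym n u v : f (sqrt_iter n u) v = f u (sqrt_iter n v).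
Proof.
elim: n u v => [|n IH] u v /=; first by rewrite dot0l dot0r.
rewrite dotZl dotZr dotDl dotDr symD !IH fmorphV /=; congr (_^-1 * _).
by rewrite conjC_nat.
Qed.

Lemma sqrt_iter_comm (Z : V -> V) : linear Z -> (forall v, Z (D v) = D (Z v)) ->
  forall n v, Z (sqrt_iter n v) = sqrt_iter n (Z v).
Proof.
move=> linZ ZD; elim=> [|n IH] v /=; first by rewrite lin_0.
by rewrite (lin_Z linZ) (lin_D linZ) ZD !IH.
Qed.

Lemma sqrt_iter_cvg v : exists l, hlim f (sqrt_iter^~ v) l.
Proof.
apply: cV => e e0.
have n1 : 0 < hnorm f v + 1 by rewrite ltr_wpDl ?hnorm_ge0.
have [N hN] := sqrt_majorant_cauchy (divr_gt0 e0 (mulr_gt0 (ltr0n R 2) n1)).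
have h n : (N <= n)%N -> hnorm f (sqrt_iter n v - sqrt_iter N v) < e / 2.
  move=> Nn; have := hN _ Nn; rewrite -(subnKC Nn).
  have := hnorm_sqrt_iterB N (n - N) v.
  rewrite ltr_pdivlMr ?mulr_gt0 //.
  move: (_ - _) (hnorm_ge0 f v) n1 => d h0 n1 h1 h2.
  have := hnorm_ge0 f (sqrt_iter (N + (n - N)) v - sqrt_iter N v).
  nra.
exists N => m n /h hm /h hn; apply: le_lt_trans (hnormB_le f _ (sqrt_iter N v) _) _.
by rewrite [X in _ + X]hnormBC; lra.
Qed.

(** The root is [1 - y], with [y] the pointwise limit of the iterates. The last clause lets
    intertwining relations pass from [D] to the root, and from there to the polar part. *)
Lemma sqrt_of_one_minus : exists s : V -> V,
  [/\ linear s, hbounded f f s, (forall u v, f (s u) v = f u (s v)),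
      (forall v, s (s v) = v - D v) &
      forall Z : V -> V, linear Z -> hbounded f f Z ->
        (forall v, Z (D v) = D (Z v)) -> forall v, Z (s v) = s (Z v)].
Proof.
have /choice[y hy] := sqrt_iter_cvg.
have liny : linear y.
  move=> a u v; apply: hlim_uniq (hy _) _ => e e0.
  have aB : hbounded f f (fun v => a *: v).
    by exists (normc a); [exact: normc_ge0|move=> w; rewrite hnormZ].
  have lina : linear (fun v : V => a *: v).
    by move=> b w z; rewrite scalerDr !scalerA mulrC.
  have [N hN] := hlimD (hlim_bounded lina aB (hy u)) (hy v) e0.
  by exists N => n Nn; rewrite sqrt_iter_linear; apply: hN.
have ley v : hnorm f (y v) <= hnorm f v.
  rewrite -[y v]subr0; apply: (hlim_le (N := 0) (hy v)) => n _; rewrite subr0.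
  apply: le_trans (hnorm_sqrt_iter n v) _; rewrite ler_piMl ?hnorm_ge0 //.
  by have [] := sqrt_majorant_bounds R n.
have By : hbounded f f y by exists 1 => // v; rewrite mul1r.
have symy u v : f (y u) v = f u (y v).
  apply/eqP; rewrite -subr_eq0; apply/eqP/eq0_normc/eqP.
  rewrite eq_le normc_ge0 andbT.
  apply: (@le0_of_eps _ _ (hnorm f u + hnorm f v)) => [|e e0].
    by rewrite addr_ge0 ?hnorm_ge0.
  have [[M hM] [N hN]] := (hy u e e0, hy v e e0).
  pose n := maxn M N.
  have -> : f (y u) v - f u (y v) = f u (sqrt_iter n v - y v) - f (sqrt_iter n u - y u) v.
    by rewrite dotBl dotBr sqrt_iter_sym opprB [RHS]addrC subrKA.
  apply: le_trans (le_normcD _ _) _; rewrite normcN.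
  have := dot_CauchySchwarz f u (sqrt_iter n v - y v).
  have := dot_CauchySchwarz f (sqrt_iter n u - y u) v.
  have := hM n (leq_maxl _ _); have := hN n (leq_maxr _ _).
  move: (hnorm f (sqrt_iter n v - y v)) (hnorm f (sqrt_iter n u - y u)) => a b.
  by move: (hnorm_ge0 f u) (hnorm_ge0 f v); nra.
have yy v : y v = (2^-1 : R[i]) *: (D v + y (y v)).
  apply: hlim_uniq (hlim_shift (hy v)) _ => /=.
  have linh : linear (fun w : V => (2^-1 : R[i]) *: w).
    by move=> b w z; rewrite scalerDr !scalerA mulrC.
  have Bh : hbounded f f (fun w : V => (2^-1 : R[i]) *: w).
    by exists (2^-1) => // w; rewrite hnorm_half mulrC.
  apply: (hlim_bounded linh Bh); apply: hlimD; first exact: hlim_cst.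
  move=> e e0; have e2 : 0 < e / 2 by rewrite divr_gt0.
  have [[M hM] [N hN]] := (hy v _ e2, hy (y v) _ e2).
  exists (maxn M N) => n; rewrite geq_max => /andP[/hM h1 /hN h2].
  (* The iterates are contractions, so the pointwise limit of their squares is the square of their
     limit. *)
  apply: le_lt_trans (hnormB_le f _ (sqrt_iter n (y v)) _) _.
  rewrite -(lin_B (sqrt_iter_linear n)).
  have := hnorm_sqrt_iter n (sqrt_iter n v - y v).
  have [r0 r1 _] := sqrt_majorant_bounds R n.
  have := hnorm_ge0 f (sqrt_iter n v - y v).
  nra.
have comy (Z : V -> V) : linear Z -> hbounded f f Z ->
    (forall v, Z (D v) = D (Z v)) -> forall v, Z (y v) = y (Z v).
  move=> linZ BZ ZD v; apply: hlim_uniq (hlim_bounded linZ BZ (hy v)) _ => e e0.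
  have [N hN] := hy (Z v) e e0; exists N => n Nn /=.
  by rewrite sqrt_iter_comm //; apply: hN.
exists (fun v => v - y v); split.
- by move=> a u v; rewrite liny scalerBr opprD addrACA.
- exists 2 => // v; apply: le_trans (hnorm_leD f _ _) _; rewrite hnorm_opp.
  by have := ley v; lra.
- by move=> u v; rewrite dotBl dotBr symy.
- move=> v; rewrite (lin_B liny) opprB.
  have : y v + y v = D v + y (y v).
    have := yy v; set z := D v + _ => ->.
    by rewrite -scalerDl -[RHS]scale1r; congr (_ *: _); field.
  move=> e1; rewrite -addrA; congr (v + _); rewrite addrCA -opprD e1.
  by rewrite opprD addrCA subrr addr0.
- by move=> Z linZ BZ ZD v; rewrite (lin_B linZ) comy.
Qed.

End PositiveSquareRoot.

(** * Polar decomposition of an injective contraction *)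

Section PolarDecomposition.
Variables (R : realType) (V W : lmodType R[i]).
Variables (f : {dot V for (@Num.conj R[i])}) (g : {dot W for (@Num.conj R[i])}).
Variables (T : V -> W) (S : W -> V).
Hypotheses (cV : hcomplete f) (cW : hcomplete g).
Hypotheses (linT : linear T) (leT : forall v, hnorm g (T v) <= hnorm f v).
Hypothesis TS : forall v w, g (T v) w = f v (S w).
Hypothesis injT : forall v, T v = 0 -> v = 0.

(** Let [s] be a square root of [S T]. Since [s v] and [T v] have equal norms, [s v |-> T v] is
    isometric, and it extends to the whole space because injectivity of [T] makes the range of [s]
    dense. An operator intertwining both [T] and [S] commutes with [s], hence intertwines the
    extension. *)
Lemma polar_isometry : exists U : V -> W,
  [/\ linear U, (forall v, hnorm g (U v) = hnorm f v) &
    forall (B : V -> V) (B' : W -> W), linear B -> hbounded f f B ->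
      linear B' -> hbounded g g B' ->
      (forall v, T (B v) = B' (T v)) -> (forall w, B (S w) = S (B' w)) ->
      forall v, U (B v) = B' (U v)].
Proof.
have linS : linear S := adjoint_linear TS.
have ST := adjoint_sym TS.
have leS w : hnorm f (S w) <= hnorm g w.
  by rewrite -[leRHS]mul1r; apply: (adjoint_bound TS) => // v; rewrite mul1r.
pose D v := v - S (T v).
have linD : linear D.
  by move=> a u v; rewrite /D linT linS scalerBr opprD addrACA.
have leD v : hnorm f (D v) <= hnorm f v.
  rewrite -ler_sqr ?nnegrE ?hnorm_ge0 // sqr_hnormB -TS -sqr_hnorm.
  have : hnorm f (S (T v)) ^+ 2 <= hnorm g (T v) ^+ 2.
    by rewrite ler_sqr ?nnegrE ?hnorm_ge0.
  by have := sqr_ge0 (hnorm g (T v)); lra.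
have symD u v : f (D u) v = f u (D v).
  by rewrite dotBl dotBr ST TS.
have [s [lins Bs syms ss coms]] := sqrt_of_one_minus cV linD leD symD.
have nsT v : hnorm f (s v) = hnorm g (T v).
  apply/eqP; rewrite -(@eqrXn2 _ 2) ?hnorm_ge0 // !sqr_hnorm syms ss.
  by rewrite opprB addrC subrK TS.
(* A vector orthogonal to the range of the symmetric map [s] is killed by [s], hence by [T]. *)
have dense w : forall e : R, 0 < e -> exists v, hnorm f (w - s v) < e.
  pose K := [set w | forall e : R, 0 < e -> exists v, hnorm f (w - s v) < e].
  have sK : hsubspace K.
    split.
    - by move=> e e0; exists 0; rewrite (lin_0 lins) subrr hnorm0.
    - move=> u v Ku Kv e e0; have e2 : 0 < e / 2 by rewrite divr_gt0.
      have [[a ha] [b hb]] := (Ku _ e2, Kv _ e2); exists (a + b).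
      rewrite (lin_D lins) opprD addrACA.
      by apply: le_lt_trans (hnorm_leD f _ _) _; lra.
    - move=> a u Ku e e0.
      have c1 : 0 < normc a + 1 by rewrite ltr_wpDl ?normc_ge0.
      have [b hb] := Ku _ (divr_gt0 e0 c1); exists (a *: b).
      rewrite (lin_Z lins) -scalerBr hnormZ.
      move: hb; rewrite ltr_pdivlMr //.
      have := hnorm_ge0 f (u - s b); have := normc_ge0 a; nra.
  have clK : hclosed f K.
    move=> v hv e e0; have e2 : 0 < e / 2 by rewrite divr_gt0.
    have [k Kk hk] := hv _ e2; have [a ha] := Kk _ e2; exists a.
    by apply: le_lt_trans (hnormB_le f _ k _) _; lra.
  have [p Kp hp] := orthogonal_projection w cV sK clK.
  suff -> : w = p by [].
  apply/eqP; rewrite -subr_eq0; apply/eqP/injT/(@hnorm_eq0 _ _ g).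
  rewrite -nsT; suff -> : s (w - p) = 0 by rewrite hnorm0.
  apply: (dot_ext (f := f)) => v; rewrite dot0r -syms dotC.
  rewrite hp ?conjC0 // => e e0; exists v; by rewrite subrr hnorm0.
(* [G] is the closure of the graph of [s v |-> T v]; equality of norms makes it the graph of an
   isometry. *)
pose G w h := forall e : R, 0 < e ->
  exists v, hnorm f (w - s v) < e /\ hnorm g (h - T v) < e.
have G_ex w : exists h, G w h.
  have /choice[x hx] n : exists v, hnorm f (w - s v) < n.+1%:R^-1.
    by apply: dense; rewrite invr_gt0 ltr0n.
  have Tc : hcauchy g (T \o x).
    move=> e e0; have [N hN] := invSn_lt (divr_gt0 e0 (ltr0n R 2)).
    exists N => m n /hN hm /hN hn /=; rewrite -(lin_B linT) -nsT (lin_B lins).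
    apply: le_lt_trans (hnormB_le f _ w _) _.
    rewrite [X in X + _]hnormBC.
    by have := lt_trans (hx m) hm; have := lt_trans (hx n) hn; lra.
  have [h hh] := cW Tc; exists h => e e0.
  have [[M hM] [N hN]] := (hh e e0, invSn_lt e0).
  exists (x (maxn M N)); split.
    by apply: lt_trans (hx _) _; apply: hN; rewrite leq_maxr.
  by rewrite hnormBC; apply: hM; rewrite leq_maxl.
have [U hU] := choice G_ex.
have G_norm w h : G w h -> hnorm g h = hnorm f w.
  move=> Gwh; apply/eqP; rewrite eq_le; apply/andP; split;
    apply/ler_addgt0Pl => e e0;
    have [v [h1 h2]] := Gwh _ (divr_gt0 e0 (ltr0n R 2)).
    have := hnormB_le g h (T v) 0; have := hnormB_le f (s v) w 0.
    by rewrite !subr0 (hnormBC f (s v)) nsT; lra.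
  have := hnormB_le f w (s v) 0; have := hnormB_le g (T v) h 0.
  by rewrite !subr0 (hnormBC g (T v)) nsT; lra.
have G_lin a w w' h h' : G w h -> G w' h' -> G (a *: w + w') (a *: h + h').
  move=> Gwh Gwh' e e0; have e2 : 0 < e / 2 by rewrite divr_gt0.
  have c1 : 0 < normc a + 1 by rewrite ltr_wpDl ?normc_ge0.
  have [v [h1 h2]] := Gwh _ (divr_gt0 e2 c1); have [v' [h1' h2']] := Gwh' _ e2.
  exists (a *: v + v'); rewrite lins linT.
  rewrite !opprD [_ + w' + _]addrACA [_ + h' + _]addrACA -!scalerBr.
  move: h1 h2; rewrite !ltr_pdivlMr // => h1 h2.
  split; (apply: le_lt_trans; first exact: hnorm_leD); rewrite hnormZ.
    by have := hnorm_ge0 f (w - s v); have := normc_ge0 a; nra.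
  by have := hnorm_ge0 g (h - T v); have := normc_ge0 a; nra.
have G_uniq w h h' : G w h -> G w h' -> h = h'.
  move=> h1 h2; apply/eqP; rewrite -subr_eq0; apply/eqP/(@hnorm_eq0 _ _ g).
  have := G_norm _ _ (G_lin (-1) _ _ _ _ h2 h1).
  by rewrite !scaleN1r addNr hnorm0 addrC.
exists U; split.
- by move=> a u v; apply: G_uniq (hU _) _; apply: G_lin.
- by move=> v; apply: G_norm.
- move=> B B' linB [b b0 hb] linB' [b' b0' hb'] TB BS v.
  apply: G_uniq (hU _) _ => e e0.
  have c1 : 0 < b + b' + 1 by lra.
  have [u [h1 h2]] := hU v _ (divr_gt0 e0 c1); exists (B u).
  have <- : B (s u) = s (B u).
    apply: coms => //; first by exists b.
    by move=> z; rewrite /D (lin_B linB) BS TB.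
  rewrite TB -(lin_B linB) -(lin_B linB').
  move: h1 h2; rewrite !ltr_pdivlMr // => h1 h2.
  have := hb (v - s u); have := hb' (U v - T u).
  have := hnorm_ge0 f (v - s u); have := hnorm_ge0 g (U v - T u).
  by move=> *; split; nra.
Qed.

End PolarDecomposition.

(** * Finite direct sums of Hilbert spaces *)

Section DirectSum.
Variables (R : realType) (V : lmodType R[i]) (f : {dot V for (@Num.conj R[i])}).
Variable I : finType.
Implicit Types (u v : {ffun I -> V}) (i : I) (x : V).

Definition dotsum (u v : {ffun I -> V}) : R[i] := \sum_i f (u i) (v i).

Lemma dotsum_bilinear : bilinear_for
  (GRing.Scale.Law.clone _ _ ( *%R ) _)
  (GRing.Scale.Law.clone _ _ (@Num.conj R[i] \; *%R ) _) dotsum.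
Proof.
split=> [w|w] a u v /=; rewrite /dotsum mulr_sumr -big_split /=;
  apply: eq_bigr => i _; rewrite !ffunE.
- by rewrite dotDl dotZl.
- by rewrite dotDr dotZr.
Qed.

HB.instance Definition _ := bilinear_isBilinear.Build R[i] _ _ _
  (GRing.Scale.Law.clone _ _ ( *%R ) _)
  (GRing.Scale.Law.clone _ _ (@Num.conj R[i] \; *%R ) _) dotsum dotsum_bilinear.

Lemma dotsum_hermitian u v :
  dotsum u v = (-1) ^+ false * Num.conj (dotsum v u).
Proof.
rewrite expr0 mul1r rmorph_sum; apply: eq_bigr => i _; exact: dotC.
Qed.

HB.instance Definition _ := isHermitianSesquilinear.Build R[i] _ false
  (@Num.conj R[i]) dotsum dotsum_hermitian.

Lemma dotsum_gt0 u : u != 0 -> 0 < dotsum u u.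
Proof.
move=> u0; rewrite lt_def sumr_ge0 => [|i _]; last exact: dnorm_ge0.
rewrite andbT; apply: contra_neq u0 => h; apply/ffunP => i; rewrite ffunE.
apply/eqP; rewrite -(dnorm_eq0 f); apply/eqP.
move: (h) => /eqP; rewrite psumr_eq0 => [|j _]; last exact: dnorm_ge0.
by move=> /allP/(_ i); rewrite mem_index_enum => /(_ isT)/eqP.
Qed.

HB.instance Definition _ := isDotProduct.Build R[i] _ dotsum dotsum_gt0.

Definition dsum : {dot {ffun I -> V} for (@Num.conj R[i])} := dotsum.

Lemma dsumE u v : dsum u v = \sum_i f (u i) (v i).
Proof. by []. Qed.

Lemma sqr_hnorm_dsum u : hnorm dsum u ^+ 2 = \sum_i hnorm f (u i) ^+ 2.
Proof.
apply: complexI; rewrite -dot_hnorm rmorph_sum /=; apply: eq_bigr => i _.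
exact: dot_hnorm.
Qed.

Lemma hnorm_coord u i : hnorm f (u i) <= hnorm dsum u.
Proof.
rewrite -ler_sqr ?nnegrE ?hnorm_ge0 // sqr_hnorm_dsum (bigD1 i) //= lerDl.
by apply: sumr_ge0 => j _; apply: sqr_ge0.
Qed.

Definition dinj (i : I) (x : V) : {ffun I -> V} := [ffun j => if j == i then x else 0].

Lemma dinj_linear i : linear (dinj i).
Proof.
by move=> a u v; apply/ffunP => j; rewrite !ffunE; case: eqP; rewrite ?scaler0 ?addr0.
Qed.

Lemma dsum_dinjl i x u : dsum (dinj i x) u = f x (u i).
Proof.
rewrite dsumE (bigD1 i) //= ffunE eqxx big1 ?addr0 // => j /negPf ji.
by rewrite ffunE ji dot0l.
Qed.

Lemma dsum_dinjr i x u : dsum u (dinj i x) = f (u i) x.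
Proof. by rewrite dotC dsum_dinjl -dotC. Qed.

Lemma hnorm_dinj i x : hnorm dsum (dinj i x) = hnorm f x.
Proof. by rewrite /hnorm dsum_dinjl ffunE eqxx. Qed.

Lemma hnorm_dsum_le u : hnorm dsum u <= \sum_i hnorm f (u i).
Proof.
have {1}-> : u = \sum_i dinj i (u i).
  apply/ffunP => j; rewrite sum_ffunE (bigD1 j) //= ffunE eqxx big1 ?addr0 // => i.
  by rewrite ffunE eq_sym => /negPf ->.
apply: le_trans (hnorm_sum _ _) _.
by apply: ler_sum => i _; rewrite hnorm_dinj.
Qed.

Lemma dsum_complete : hcomplete f -> hcomplete dsum.
Proof.
move=> cV x xc.
have /choice[l hl] i : exists l, hlim f (fun n => x n i) l.
  apply: cV => e /xc[N hN]; exists N => m n Nm Nn.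
  apply: le_lt_trans (hN m n Nm Nn).
  by have := hnorm_coord (x m - x n) i; rewrite !ffunE.
exists [ffun i => l i] => e e0.
(* The [+ 1] covers an empty index set and makes the final inequality strict. *)
have c1 : 0 < #|I|%:R + 1 :> R by rewrite ltr_wpDl.
have e1 := divr_gt0 e0 c1.
have /choice[M hM] i := hl i _ e1.
exists (\max_i M i) => n hn; apply: le_lt_trans (hnorm_dsum_le _) _.
apply: (@le_lt_trans _ _ (\sum_(i : I) e / (#|I|%:R + 1))).
  apply: ler_sum => i _; rewrite !ffunE; apply/ltW/hM.
  by apply: leq_trans hn; apply: leq_bigmax.
rewrite sumr_const -[X in X < _]mulr_natr mulrAC ltr_pdivrMr // ltr_pM2l //; lra.
Qed.

Lemma dsum_map_bounded (B : V -> V) : hbounded f f B ->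
  hbounded dsum dsum (fun u => [ffun i => B (u i)]).
Proof.
case=> c c0 hc; exists c => // u.
rewrite -ler_sqr ?nnegrE ?hnorm_ge0 ?mulr_ge0 ?hnorm_ge0 //.
rewrite exprMn !sqr_hnorm_dsum mulr_sumr; apply: ler_sum => i _; rewrite ffunE.
by rewrite -exprMn ler_sqr ?nnegrE ?hnorm_ge0 ?mulr_ge0 ?hnorm_ge0.
Qed.

Lemma dsum_map_linear (B : V -> V) : linear B ->
  linear (fun u : {ffun I -> V} => [ffun i => B (u i)]).
Proof. by move=> linB a u v; apply/ffunP => i; rewrite !ffunE linB. Qed.

End DirectSum.

(** * Intertwiners in a finite von Neumann algebra *)

Section Projector.
Variables (R : realType) (V : lmodType R[i]) (f : {dot V for (@Num.conj R[i])}).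

Lemma orthogonal_complement_projector (K : set V) :
  hcomplete f -> hsubspace K -> hclosed f K ->
  exists q : V -> V,
    [/\ linear q, (forall v, K (v - q v)),
        (forall v k, K k -> f (q v) k = 0),
        (forall u v, f (q u) v = f u (q v)) &
        (forall v, hnorm f (q v) <= hnorm f v)].
Proof.
move=> cV sK clK; have [K0 KD KZ] := sK.
have /choice[q hq] v : exists w, K (v - w) /\ forall k, K k -> f w k = 0.
  have [p Kp hp] := orthogonal_projection v cV sK clK.
  by exists (v - p); rewrite opprB addrC subrK.
have Kq v : K (v - q v) by case: (hq v).
have qK v k : K k -> f (q v) k = 0 by case: (hq v) => _; apply.
have symq u v : f (q u) v = f u (q v).
  have -> : f (q u) v = f (q u) (q v).
    by apply/eqP; rewrite -subr_eq0 -dotBr (qK _ _ (Kq v)).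
  apply/eqP; rewrite -subr_eq0 -oppr_eq0.
  by rewrite opprB -dotBl dotC (qK _ _ (Kq u)) conjC0.
exists q; split=> //.
(* Linearity is a consequence of symmetry. *)
- move=> a u v; apply: (dot_ext (f := f)) => w.
  by rewrite -symq !dotDr !dotZr !symq.
- move=> v; rewrite -ler_sqr ?nnegrE ?hnorm_ge0 //.
  have {2}-> : v = q v + (v - q v) by rewrite addrC subrK.
  by rewrite sqr_hnormD (qK _ _ (Kq v)) mulr0 addr0 lerDl sqr_ge0.
Qed.

(** The difference [q (B v) - B (q v)] lies in [K], being [B (v - q v) - (B v - q (B v))], and it is
    also orthogonal to [K]. *)
Lemma projector_comm (K : set V) (q B : V -> V) :
  hsubspace K -> linear B ->
  (forall v, K (v - q v)) -> (forall v k, K k -> f (q v) k = 0) ->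
  (forall k, K k -> K (B k)) ->
  (forall w, (forall k, K k -> f w k = 0) -> forall k, K k -> f (B w) k = 0) ->
  forall v, q (B v) = B (q v).
Proof.
move=> sK linB Kq qK BK BW v.
apply/eqP; rewrite -subr_eq0 -(dnorm_eq0 f).
have Kd : K (q (B v) - B (q v)).
  have -> : q (B v) - B (q v) = B (v - q v) - (B v - q (B v)).
    by rewrite (lin_B linB) opprB [RHS]addrC subrKA.
  by apply: hsubspaceB => //; apply: BK.
by rewrite {1}dotBl qK // BW // ?subrr // => k; apply: qK.
Qed.

Lemma isometry_dot (W : lmodType R[i]) (g : {dot W for (@Num.conj R[i])})
    (U : V -> W) : linear U -> (forall v, hnorm g (U v) = hnorm f v) ->
  forall u v, g (U u) (U v) = f u v.
Proof.
move=> linU isoU.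
have re u v : Re (g (U u) (U v)) = Re (f u v).
  have := sqr_hnormD g (U u) (U v).
  by rewrite -(lin_D linU) !isoU sqr_hnormD; lra.
(* Replacing [u] by ['i *: u] turns equality of real parts into equality of imaginary parts. *)
move=> u v; have := re ('i *: u) v.
rewrite (lin_Z linU) !dotZl => im; have := re u v.
move: im; case: (g _ _) => a b; case: (f _ _) => c d /=.
rewrite !mul0r !mul1r !sub0r => /oppr_inj -> ->; by [].
Qed.

(** If [k] in [D] is close to [w], then [f w w = f w (w - k)] is small. This is how the density
    statements are used to annihilate vectors. *)
Lemma ortho_dense (w : V) (D : set V) :
  (forall e : R, 0 < e -> exists2 k, D k & hnorm f (w - k) < e) ->
  (forall k, D k -> f w k = 0) -> w = 0.
Proof.
move=> hw wD; apply/eqP; rewrite -(dnorm_eq0 f); apply/eqP/eq0_normc/eqP.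
rewrite eq_le normc_ge0 andbT; apply: (le0_of_eps (hnorm_ge0 f w)) => e e0.
have [k Dk hk] := hw e e0.
have -> : f w w = f w (w - k) by rewrite dotBr (wD _ Dk) subr0.
apply: le_trans (dot_CauchySchwarz _ _ _) _.
by apply: ler_wpM2l; [exact: hnorm_ge0|exact: ltW].
Qed.

End Projector.

(** * Operators on [H] and the finiteness of [M] *)

Section Operators.
Variables (R : realType) (H : completeNormedModType R[i]).
Variable dot : {dot H for (@Num.conj R[i])}.
Hypothesis hdot : dot_induces_norm dot.
Implicit Types (T S B : H -> H) (x y : H) (M : set (H -> H)).

Lemma normr_hnorm x : `|x| = (hnorm dot x)%:C.
Proof.
apply/eqP; rewrite -(@eqrXn2 _ 2) ?normr_ge0 //; last by rewrite ler0c hnorm_ge0.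
by rewrite hdot dot_hnorm (rmorphXn (real_complex R)).
Qed.

Lemma bounded_operator_hbounded T :
  bounded_operator T <-> linear T /\ hbounded dot dot T.
Proof.
split=> [[linT [c hc]]|[linT [c c0 hc]]]; split=> //.
  (* A nonzero vector forces [c] to be nonnegative; if [H] is zero, [c] is arbitrary, hence the
     modulus. *)
  exists (normc c) => [|x]; first exact: normc_ge0.
  have := hc x; rewrite !normr_hnorm => h.
  rewrite -lecR -normr_hnorm.
  have -> : (normc c * hnorm dot x)%:C = `|c| * `|x|.
    by rewrite normr_hnorm normr_normc -(rmorphM (real_complex R)).
  have [->|x0] := eqVneq x 0; first by rewrite (lin_0 linT) normr0 mulr0.
  have nx0 : 0 < `|x| by rewrite normr_gt0.
  have c0 : 0 <= c by rewrite -(ler_pM2r nx0) mul0r; apply: le_trans (hc x).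
  by rewrite ger0_norm.
by exists c%:C => x; rewrite !normr_hnorm -(rmorphM (real_complex R)) lecR.
Qed.

Lemma normed_complete : hcomplete dot.
Proof.
move=> x xc.
have cx : cvg (x @ \oo).
  apply: cauchy_cvg; apply: cauchy_exP => _ /gt0_real_complex[e /xc[N hN] ->].
  exists (x N), N => // n /= Nn.
  by rewrite -ball_normE /ball_ /= normr_hnorm ltcR; apply: hN.
exists (lim (x @ \oo)) => e e0.
have e1 : 0 < e%:C by rewrite ltcR.
have [N _ hN] := (cvgrPdist_lt _ _).1 cx _ e1.
by exists N => n /hN; rewrite normr_hnorm ltcR hnormBC.
Qed.

(** [M] is self-adjoint, so commutation of the adjoint with [N] follows from commutation of [T] with
    the adjoint of [N]. *)
Lemma commutant_adjoint M T : von_neumann_algebra dot M -> commutant M T ->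
  exists2 S, commutant M S & forall v w, dot (T v) w = dot v (S w).
Proof.
move=> [_ Madj _] [/bounded_operator_hbounded[linT bT] TM].
have [S TS] := adjoint_exists normed_complete linT bT.
exists S => //; split.
  apply/bounded_operator_hbounded; split; first exact: adjoint_linear TS.
  exact: adjoint_hbounded TS bT.
move=> N MN; have [N' MN' NN'] := Madj N MN.
have N'N := adjoint_sym NN'.
apply/funext => w; apply: (dot_ext (f := dot)) => v /=.
rewrite -TS -!N'N -TS; congr (dot _ w).
by have /(congr1 (fun F => F v)) /= := TM N' MN'.
Qed.

(** With [S] the adjoint of [U], [S \o U] is the identity and [U \o S] is a projection of [M]
    equivalent to it; finiteness makes the two equal. *)
Lemma isometry_surjective M U : finite_von_neumann_algebra dot M -> M U ->
  (forall x, hnorm dot (U x) = hnorm dot x) -> forall y, exists x, U x = y.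
Proof.
move=> [[[Mb _ _ _ Mc] Madj _] [Mid _ fin]] MU isoU y.
have [linU _] := Mb U MU.
have [S MS US] := Madj U MU.
have SU : S \o U = id.
  apply/funext => x; apply: (dot_ext (f := dot)) => w /=.
  by rewrite -US (isometry_dot linU isoU).
have SUx x : S (U x) = x by have /(congr1 (fun F => F x)) := SU.
have MQ : M (U \o S) by apply: Mc.
have Qid : U \o S = id.
  apply: (fin (U \o S)) => //.
    split; first exact: Mb.
      by apply/funext => x /=; rewrite SUx.
    by move=> x z /=; rewrite US (adjoint_sym US).
  by exists U, S; split.
by exists (S y); have /(congr1 (fun F => F y)) := Qid.
Qed.

(* If phi were injective, its polar part would give two isometries of M with
   orthogonal ranges; finiteness makes the first one surjective. *)
Lemma intertwiner_not_injective M (phi : {ffun bool -> H} -> H)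
    (S : H -> {ffun bool -> H}) (x0 : H) :
  finite_von_neumann_algebra dot M -> x0 != 0 -> linear phi ->
  (forall v, hnorm dot (phi v) <= hnorm (dsum dot bool) v) ->
  (forall v w, dot (phi v) w = dsum dot bool v (S w)) ->
  (forall B, commutant M B ->
     forall v : {ffun bool -> H}, phi [ffun i => B (v i)] = B (phi v)) ->
  exists2 v, v != 0 & phi v = 0.
Proof.
move=> finM x00 linphi lephi phiS phiB.
have [vM _] := finM; have [[Mb _ _ _ _] Madj MM] := vM.
apply: contrapT => noninj.
have injphi v : phi v = 0 -> v = 0.
  move=> hv; apply/eqP; apply: contra_notT noninj => v0; by exists v.
have cH := normed_complete.
have [U [linU isoU comU]] :=
  polar_isometry (dsum_complete (I := bool) cH) cH linphi lephi phiS injphi.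
pose W b x := U (dinj b x).
have linW b : linear (W b) by move=> a x y; rewrite /W dinj_linear linU.
have isoW b x : hnorm dot (W b x) = hnorm dot x by rewrite /W isoU hnorm_dinj.
(* [U] intertwines the action of the commutant, so [W b] lies in the bicommutant, which is [M]. *)
have MW b : M (W b).
  rewrite -MM; split.
    apply/bounded_operator_hbounded; split=> //.
    by exists 1 => // x; rewrite isoW mul1r.
  move=> B cB; apply/funext => x /=.
  have [/bounded_operator_hbounded[linB bB] _] := cB.
  have [B' cB' BB'] := commutant_adjoint vM cB.
  have [/bounded_operator_hbounded[linB' bB'] _] := cB'.
  have B'B := adjoint_sym BB'.
  rewrite /W -(comU (fun v => [ffun i => B (v i)]) B) //.
  - congr U; apply/ffunP => i; rewrite !ffunE; case: eqP => //.
    by rewrite (lin_0 linB).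
  - exact: dsum_map_linear.
  - exact: dsum_map_bounded.
  - exact: phiB.
  - move=> w; apply: (dot_ext (f := dsum dot bool)) => v.
    rewrite -phiS -B'B -phiB // phiS !dsumE.
    by apply: eq_bigr => i _; rewrite !ffunE B'B.
(* Since [W true] is onto, [W false x0 = W true z] for some [z]; the isometry [U] then kills a
   vector whose [false] coordinate is [x0]. *)
have [z hz] := isometry_surjective finM (MW true) (isoW true) (W false x0).
have : U (dinj false x0 - dinj true z) = 0.
  by rewrite (lin_B linU) -/(W false x0) -hz subrr.
move/(congr1 (hnorm dot)); rewrite isoU hnorm0 => /hnorm_eq0.
move/ffunP/(_ false); rewrite !ffunE /= subr0 => /eqP.
by rewrite (negPf x00).
Qed.

End Operators.

(** * Multiple transitivity *)

Section FreeFamilies.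
Variables (K : fieldType) (V : lmodType K).

Definition free_family n (X : 'I_n -> V) : Prop :=
  forall c : 'I_n -> K, \sum_i c i *: X i = 0 -> forall i, c i = 0.

(** Dropping [X j] after adding a multiple of it to another member keeps the family free. A linear
    relation between two coordinates of an annihilating vector leads to such a family. *)
Lemma free_family_lift n (X : 'I_n.+1 -> V) (j : 'I_n.+1) (i0 : 'I_n) (a : K) :
  free_family X ->
  free_family (fun i => X (lift j i) + (if i == i0 then a else 0) *: X j).
Proof.
move=> frX c hc i.
pose d k := if unlift j k is Some i then c i else c i0 * a.
have := frX d; rewrite (bigD1_ord j) //= /d unlift_none.
have -> : \sum_(i < n)
    (if unlift j (lift j i) is Some i then c i else c i0 * a) *: X (lift j i) =
    \sum_i c i *: X (lift j i).
  by apply: eq_bigr => k _; rewrite liftK.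
have -> : (c i0 * a) *: X j = \sum_i c i *: ((if i == i0 then a else 0) *: X j).
  rewrite (bigD1 i0) //= eqxx big1 ?addr0 ?scalerA // => k /negPf ->.
  by rewrite scale0r scaler0.
rewrite addrC -big_split /=; under eq_bigr do rewrite -scalerDr.
by move=> /(_ hc (lift j i)); rewrite liftK.
Qed.

Definition in_span n (X : 'I_n -> V) x := exists c : 'I_n -> K, x = \sum_i c i *: X i.

Definition cons_family n (x : V) (X : 'I_n -> V) (i : 'I_n.+1) : V :=
  if unlift ord0 i is Some j then X j else x.

Lemma free_family_cons n (x : V) (X : 'I_n -> V) :
  free_family X -> ~ in_span X x -> free_family (cons_family x X).
Proof.
move=> frX nX c; rewrite (bigD1_ord ord0) //= /cons_family unlift_none.
under eq_bigr do rewrite liftK.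
move=> hc; have c0 : c ord0 = 0.
  apply/eqP/negP => /negP c0; apply: nX.
  exists (fun i => - (c ord0)^-1 * c (lift ord0 i)).
  under eq_bigr do rewrite -scalerA.
  rewrite -scaler_sumr; apply: (scalerI c0).
  by rewrite scalerA mulrN divff // scaleN1r; apply/eqP; rewrite -addr_eq0 hc.
move: hc; rewrite c0 scale0r add0r => hc i.
by case: (unliftP ord0 i) => [j ->|->//]; exact: (frX (fun j => c (lift ord0 j)) hc j).
Qed.

End FreeFamilies.

(** * Orbit closures, their annihilators and the induction on the number of vectors *)

Section Transitivity.
Variables (R : realType) (H : completeNormedModType R[i]).
Variable dot : {dot H for (@Num.conj R[i])}.
Hypothesis hdot : dot_induces_norm dot.
Variable A : set (H -> H).
Hypothesis trA : transitive_algebra A.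
Implicit Types (T S B : H -> H) (x y : H).

Local Notation Hn n := {ffun 'I_n -> H}.

Definition app n T (X : 'I_n -> H) : Hn n := [ffun i => T (X i)].

Definition orbit_closure n (X : 'I_n -> H) : set (Hn n) :=
  [set w | forall e : R, 0 < e ->
     exists2 T, A T & hnorm (dsum dot 'I_n) (w - app T X) < e].

Definition fold_transitive n : Prop :=
  forall X : 'I_n -> H, free_family X -> orbit_closure X = setT.

Let A_lin T : A T -> linear T.
Proof. by move=> AT; have [[/(_ T AT)[]]] := trA. Qed.

Let A_bounded T : A T -> hbounded dot dot T.
Proof.
move=> AT; have [[/(_ T AT) bT _ _ _ _] _ _] := trA.
by case/(bounded_operator_hbounded hdot): bT.
Qed.

Lemma orbit_closure_orbit n (X : 'I_n -> H) T : A T -> orbit_closure X (app T X).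
Proof. by move=> AT e e0; exists T => //; rewrite subrr hnorm0. Qed.

Lemma orbit_closure_subspace n (X : 'I_n -> H) : hsubspace (orbit_closure X).
Proof.
have [[_ A0 AD AZ _] _ _] := trA; split.
- move=> e e0; exists (fun=> 0) => //.
  suff -> : app (fun=> 0) X = 0 by rewrite subrr hnorm0.
  by apply/ffunP => i; rewrite !ffunE.
- move=> u v Ku Kv e e0; have e2 : 0 < e / 2 by rewrite divr_gt0.
  have [[S AS hS] [T AT hT]] := (Ku _ e2, Kv _ e2).
  exists (fun x => S x + T x); first exact: AD.
  have -> : app (fun x => S x + T x) X = app S X + app T X.
    by apply/ffunP => i; rewrite !ffunE.
  rewrite opprD addrACA.
  by apply: le_lt_trans (hnorm_leD _ _ _) _; lra.
- move=> a u Ku e e0.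
  have c1 : 0 < normc a + 1 by rewrite ltr_wpDl ?normc_ge0.
  have [T AT hT] := Ku _ (divr_gt0 e0 c1).
  exists (fun x => a *: T x); first exact: AZ.
  have -> : app (fun x => a *: T x) X = a *: app T X.
    by apply/ffunP => i; rewrite !ffunE.
  rewrite -scalerBr hnormZ; move: hT; rewrite ltr_pdivlMr //.
  have := hnorm_ge0 (dsum dot 'I_n) (u - app T X); have := normc_ge0 a; nra.
Qed.

Lemma orbit_closure_closed n (X : 'I_n -> H) :
  hclosed (dsum dot 'I_n) (orbit_closure X).
Proof.
move=> v hv e e0; have e2 : 0 < e / 2 by rewrite divr_gt0.
have [k Kk hk] := hv _ e2; have [T AT hT] := Kk _ e2; exists T => //.
by apply: le_lt_trans (hnormB_le _ _ k _) _; lra.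
Qed.

Lemma orbit_closure_invariant n (X : 'I_n -> H) T (w : Hn n) :
  A T -> orbit_closure X w -> orbit_closure X (app T w).
Proof.
move=> AT Kw e e0; have [[_ _ _ _ AM] _ _] := trA.
have [c c0 hc] := dsum_map_bounded 'I_n (A_bounded AT).
have c1 : 0 < c + 1 by rewrite ltr_wpDl.
have [S AS hS] := Kw _ (divr_gt0 e0 c1).
exists (T \o S); first exact: AM.
have -> : app T w - app (T \o S) X = [ffun i => T ((w - app S X) i)].
  by apply/ffunP => i; rewrite !ffunE (lin_B (A_lin AT)).
apply: le_lt_trans (hc _) _; move: hS; rewrite ltr_pdivlMr //.
have := hnorm_ge0 (dsum dot 'I_n) (w - app S X); nra.
Qed.

(** As [w j = a *: w k], the term of index [j] merges into that of index [k]: the other coordinates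
    of [w] annihilate the orbit of the [n] free vectors obtained by adding [Num.conj a *: X j] to
    [X k]. That orbit is dense by hypothesis. The case [a = 0] says that one vanishing coordinate
    kills [w]. *)
Lemma annihilator_relation n (X : 'I_n.+1 -> H) (w : Hn n.+1) (j k : 'I_n.+1) (a : R[i]) :
  fold_transitive n -> free_family X ->
  (forall v, orbit_closure X v -> dsum dot 'I_n.+1 w v = 0) ->
  j != k -> w j = a *: w k -> w = 0.
Proof.
move=> Pn frX wK jk wj.
have [i0 ki0] : exists i0, k = lift j i0.
  by case: (unliftP j k) jk => [i ->|->]; [exists i|rewrite eqxx].
have frY := free_family_lift (j := j) (i0 := i0) (a := Num.conj a) frX.
set Y := (fun i => _) in frY.
pose w' : Hn n := [ffun i => w (lift j i)].
have w'0 : w' = 0.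
  apply: (@ortho_dense _ _ (dsum dot 'I_n) w' [set app T Y | T in A]).
    move=> e e0; have : orbit_closure Y w' by rewrite (Pn _ frY).
    by move=> /(_ e e0)[T AT hT]; exists (app T Y) => //; exists T.
  move=> _ [T AT <-]; have := wK _ (orbit_closure_orbit X AT).
  rewrite !dsumE (bigD1_ord j) //= wj ffunE dotZl => h; rewrite -[RHS]h {h}.
  have -> : a * dot (w k) (T (X j)) =
      \sum_i dot (w (lift j i)) ((if i == i0 then Num.conj a else 0) *: T (X j)).
    rewrite (bigD1 i0) //= eqxx big1 => [|i /negPf ->]; last first.
      by rewrite scale0r dot0r.
    by rewrite addr0 dotZr conjCK ki0.
  rewrite -big_split /=; apply: eq_bigr => i _.
  rewrite !ffunE -dotDr /Y; congr (dot _ _).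
  by rewrite addrC (lin_D (A_lin AT)) (lin_Z (A_lin AT)).
have wl i : w (lift j i) = 0 by have /ffunP/(_ i) := w'0; rewrite !ffunE.
apply/ffunP => i; rewrite ffunE; case: (unliftP j i) => [i' ->|->]; first exact: wl.
by rewrite wj ki0 wl scaler0.
Qed.

(** The vectors approximable by some [T x] form a closed invariant subspace, which contains [x]
    because [A] contains the identity; transitivity makes it the whole of [H]. *)
Lemma one_fold_approx x y (e : R) : x != 0 -> 0 < e ->
  exists2 T, A T & hnorm dot (y - T x) < e.
Proof.
move=> x0 e0; have [[_ A0 AD AZ AM] Aid Atr] := trA.
(* One-element families make the lemmas on orbit closures available. *)
pose V := [set v | orbit_closure (fun _ : 'I_1 => x) [ffun=> v]].
have VE v : V v <-> forall e : R, 0 < e -> exists2 T, A T & hnorm dot (v - T x) < e.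
  have nE T : hnorm (dsum dot 'I_1) ([ffun=> v] - app T (fun=> x)) = hnorm dot (v - T x).
    apply/eqP; rewrite -(@eqrXn2 _ 2) ?hnorm_ge0 // sqr_hnorm_dsum big_ord1.
    by rewrite !ffunE.
  by split=> h d /h[T AT hT]; exists T => //; move: hT; rewrite nE.
have sV : hsubspace V.
  have [K0 KD KZ] := orbit_closure_subspace (fun _ : 'I_1 => x).
  split.
  - by rewrite /V /= (_ : [ffun=> 0] = 0) //; apply/ffunP => i; rewrite !ffunE.
  - move=> u v Vu Vv; rewrite /V /= (_ : [ffun=> u + v] = [ffun=> u] + [ffun=> v]).
      exact: KD.
    by apply/ffunP => i; rewrite !ffunE.
  - move=> a u Vu; rewrite /V /= (_ : [ffun=> a *: u] = a *: [ffun=> u]).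
      exact: KZ.
    by apply/ffunP => i; rewrite !ffunE.
have cV : closed V.
  move=> v hv; apply/VE => d d0; have d2 : 0 < d / 2 by rewrite divr_gt0.
  have dC : 0 < (d / 2)%:C by rewrite ltcR.
  have [z [/VE/(_ _ d2)[T AT hT]]] := hv _ (nbhsx_ballx v _ dC).
  rewrite -ball_normE /ball_ /= (normr_hnorm hdot) ltcR => hz; exists T => //.
  by apply: le_lt_trans (hnormB_le _ _ z _) _; lra.
have iV : Defs.invariant A V.
  move=> T v AT Vv; rewrite /V /=.
  have := orbit_closure_invariant AT Vv.
  by rewrite (_ : app T _ = [ffun=> T v]) //; apply/ffunP => i; rewrite !ffunE.
have [V0|VT] := Atr V sV cV iV.
  have : V x by apply/VE => d d0; exists id; rewrite ?subrr ?hnorm0.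
  by rewrite V0 /= => /eqP; rewrite (negPf x0).
have : V y by rewrite VT.
by move/VE/(_ e e0).
Qed.

Hypothesis two : two_fold_transitive A.

Lemma two_fold_approx x y u v (e : R) : linearly_independent x y -> 0 < e ->
  exists T, [/\ A T, hnorm dot (u - T x) < e & hnorm dot (v - T y) < e].
Proof.
move=> indep e0.
have : closure [set ((T x, T y) : H * H) | T in A] (u, v) by rewrite two.
have eC : 0 < e%:C by rewrite ltcR.
move=> /(_ (ball u e%:C `*` ball v e%:C)) [].
  by exists (ball u e%:C, ball v e%:C) => //; split; apply: nbhsx_ballx.
move=> _ [[T AT <-] []] /=; rewrite -ball_normE /ball_ /= !(normr_hnorm hdot) !ltcR.
by exists T.
Qed.

Variable M : set (H -> H).
Hypotheses (finM : finite_von_neumann_algebra dot M) (MA : commutant M `<=` A).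

(* The matrix compression to coordinates [0], [n] of the projection onto the
   annihilator of an orbit closure intertwines the action of the commutant. *)
Lemma orbit_closure_two_coordinates n (X : 'I_n.+2 -> H) :
  fold_transitive n.+1 -> free_family X ->
  exists2 v : {ffun bool -> H}, v != 0 &
    orbit_closure X (dinj ord0 (v false) + dinj ord_max (v true)).
Proof.
move=> Pn frX.
have cH := normed_complete hdot.
have cHn := dsum_complete (I := 'I_n.+2) cH.
have [q [linq Kq qK symq le_q]] := orthogonal_complement_projector cHn
  (orbit_closure_subspace X) (@orbit_closure_closed _ X).
(* [J] embeds two copies of [H] isometrically as the first and last coordinates; [Js] is its
   adjoint. *)
pose J (v : {ffun bool -> H}) : Hn n.+2 := dinj ord0 (v false) + dinj ord_max (v true).
pose Js (w : Hn n.+2) : {ffun bool -> H} := [ffun b => w (if b then ord_max else ord0)].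
have linJ : linear J.
  by move=> a u v; rewrite /J !ffunE !dinj_linear scalerDr addrACA.
have J_Js v w : dsum dot 'I_n.+2 (J v) w = dsum dot bool v (Js w).
  by rewrite /J dotDl !dsum_dinjl dsumE big_bool !ffunE addrC.
have JsJ v : Js (J v) = v.
  by apply/ffunP => -[]; rewrite !ffunE eqxx ?[_ == ord_max]eq_sym /= ?addr0 ?add0r.
have isoJ v : hnorm (dsum dot 'I_n.+2) (J v) = hnorm (dsum dot bool) v.
  by rewrite /hnorm J_Js JsJ.
pose phi v := q (J v) ord_max.
have linphi : linear phi by move=> a u v; rewrite /phi linJ linq !ffunE.
have lephi v : hnorm dot (phi v) <= hnorm (dsum dot bool) v.
  by rewrite -isoJ; apply: le_trans (le_q _); apply: hnorm_coord.
have phiS v w : dot (phi v) w = dsum dot bool v (Js (q (dinj ord_max w))).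
  by rewrite -J_Js -symq dsum_dinjr.
have [[Mb Madj MM] _] := finM.
(* The commutant lies in [A] and is self-adjoint, so it preserves both the orbit closure and its
   annihilator, and hence commutes with [q]. *)
have phiB B : commutant M B ->
    forall v : {ffun bool -> H}, phi [ffun i => B (v i)] = B (phi v).
  move=> cB v; have AB := MA cB; have linB := A_lin AB.
  have [B' cB' BB'] := commutant_adjoint hdot finM.1 cB.
  have B'B := adjoint_sym BB'.
  pose Bn (w : Hn n.+2) : Hn n.+2 := [ffun i => B (w i)].
  have -> : B (phi v) = Bn (q (J v)) ord_max by rewrite ffunE.
  rewrite -(projector_comm (f := dsum dot 'I_n.+2)
    (K := orbit_closure X) (q := q) (B := Bn)) //.
  - congr (q _ _); apply/ffunP => i; rewrite !ffunE (lin_D linB).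
    by congr (_ + _); case: eqP => // _; rewrite (lin_0 linB).
  - exact: orbit_closure_subspace.
  - exact: dsum_map_linear.
  - by move=> k; apply: orbit_closure_invariant.
  - move=> w hw k Kk.
    rewrite -(hw _ (orbit_closure_invariant (MA cB') Kk)) !dsumE.
    by apply: eq_bigr => i _; rewrite !ffunE BB'.
have X0 : X ord0 != 0.
  apply/eqP => X0; have := frX (fun i => (i == ord0)%:R).
  rewrite (bigD1 ord0) //= X0 scaler0 add0r big1 => [/(_ erefl ord0)|i /negPf ->].
    by move/eqP; rewrite eqxx oner_eq0.
  by rewrite scale0r.
have [v v0 phiv] := intertwiner_not_injective hdot finM X0 linphi lephi phiS phiB.
exists v => //; rewrite -/(J v).
(* The vector [q (J v)] annihilates the orbit closure and [phi v = 0] is its last coordinate, so it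
   vanishes. *)
suff qJ0 : q (J v) = 0 by have := Kq (J v); rewrite qJ0 subr0.
apply: (@annihilator_relation n.+1 X _ ord_max ord0 0) => //.
- exact: qK.
- by rewrite scale0r.
Qed.

Lemma fold_transitive_step n : fold_transitive n.+1 -> fold_transitive n.+2.
Proof.
move=> Pn X frX.
have cHn := dsum_complete (I := 'I_n.+2) (normed_complete hdot).
have [q [_ Kq qK _ _]] := orthogonal_complement_projector cHn
  (orbit_closure_subspace X) (@orbit_closure_closed _ X).
suff W0 w : (forall k, orbit_closure X k -> dsum dot 'I_n.+2 w k = 0) -> w = 0.
  rewrite -subTset => w _.
  by have := Kq w; rewrite (W0 (q w)) ?subr0 // => k; apply: qK.
move=> wK; have [v v0 Kv] := orbit_closure_two_coordinates Pn frX.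
(* The orbit closure is invariant under [A], so [T] may be applied to the two-coordinate vector
   before pairing with [w]. *)
have rel T : A T -> dot (w ord0) (T (v false)) + dot (w ord_max) (T (v true)) = 0.
  move=> AT; have := wK _ (orbit_closure_invariant AT Kv).
  have -> : app T (dinj ord0 (v false) + dinj ord_max (v true)) =
      dinj ord0 (T (v false)) + dinj (ord_max : 'I_n.+2) (T (v true)).
    apply/ffunP => i; rewrite !ffunE (lin_D (A_lin AT)).
    by congr (_ + _); case: eqP => // _; rewrite (lin_0 (A_lin AT)).
  by rewrite dotDr !dsum_dinjr.
have ann := annihilator_relation Pn frX wK.
have [indep|dep] := pselect (linearly_independent (v false) (v true)).
  (* By 2-fold transitivity the pair of first and last coordinates of [w] is a limit of pairs
     orthogonal to it. *)
  suff : w ord_max = 0 by move=> wn; apply: (ann ord_max ord0 0) => //; rewrite scale0r.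
  pose w' : {ffun bool -> H} := [ffun b => w (if b then ord_max else ord0)].
  suff /ffunP/(_ true) : w' = 0 by rewrite !ffunE.
  apply: (@ortho_dense _ _ (dsum dot bool) w' [set [ffun b => T (v b)] | T in A]).
    move=> e e0; have [T [AT h1 h2]] :=
      two_fold_approx (w ord0) (w ord_max) indep (divr_gt0 e0 (ltr0n R 2)).
    exists [ffun b => T (v b)]; first by exists T.
    apply: le_lt_trans (hnorm_dsum_le _ _) _; rewrite big_bool !ffunE /=.
    lra.
  by move=> _ [T AT <-]; rewrite dsumE big_bool !ffunE /= addrC rel.
(* In the dependent case both vectors are multiples of one nonzero [z]. The normalisation of [a] and
   [b] allows the relation below to be solved for one coordinate. *)
have [z [a [b [z0 va vb ab]]]] : exists z a b,
    [/\ z != 0, v false = a *: z, v true = b *: z & a = 1 \/ a = 0 /\ b = 1].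
  have [x0|x0] := eqVneq (v false) 0.
    exists (v true), 0, 1; rewrite scale0r scale1r; split=> //; last by right.
    apply: contra_neq v0 => y0; apply/ffunP => -[]; by rewrite ffunE.
  have [[c hc]|nc] := pselect (exists c, v true = c *: v false).
    by exists (v false), 1, c; rewrite scale1r; split=> //; left.
  case: dep => a b hab.
  have b0 : b = 0.
    apply/eqP/negP => /negP b0; apply: nc; exists (- (b^-1 * a)).
    apply: (scalerI b0); rewrite scalerA mulrN mulrA divff // mul1r scaleNr.
    by apply/eqP; rewrite -addr_eq0 addrC hab.
  split=> //; move: hab; rewrite b0 scale0r addr0 => /eqP.
  by rewrite scaler_eq0 (negPf x0) orbF => /eqP.
(* By [rel], this combination is orthogonal to every [T z], and these vectors are dense by
   transitivity. *)
have comb : Num.conj a *: w ord0 + Num.conj b *: w ord_max = 0.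
  apply: (@ortho_dense _ _ dot _ [set T z | T in A]).
    move=> e e0; have [T AT hT] := one_fold_approx
      (Num.conj a *: w ord0 + Num.conj b *: w ord_max) z0 e0.
    by exists (T z) => //; exists T.
  move=> _ [T AT <-]; rewrite dotDl !dotZl -!dotZr.
  by rewrite -!(lin_Z (A_lin AT)) -va -vb rel.
move: comb; case: ab => [->|[-> ->]]; rewrite conjC1 ?conjC0 ?scale0r ?add0r ?scale1r.
  move=> /eqP; rewrite addr_eq0 -scaleNr => /eqP; exact: ann.
by move=> wn; apply: (ann ord_max ord0 0) => //; rewrite scale0r.
Qed.

Lemma fold_transitive_all n : fold_transitive n.
Proof.
(* Rank 0 is included because [finite_control] may return an empty family. *)
case: n => [|n].
  have [[_ A0 _ _ _] _ _] := trA.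
  move=> X _; rewrite -subTset => w _ e e0; exists (fun=> 0) => //.
  by rewrite (_ : w - _ = 0) ?hnorm0 //; apply/ffunP => -[].
elim: n => [|n IH]; last exact: fold_transitive_step.
move=> X frX; rewrite -subTset => w _ e e0.
have X0 : X ord0 != 0.
  apply/eqP => X0; have := frX (fun=> 1).
  rewrite big_ord1 X0 scaler0 => /(_ erefl ord0) /eqP.
  by rewrite oner_eq0.
have [T AT hT] := one_fold_approx (w ord0) X0 e0; exists T => //.
rewrite -ltr_sqr ?nnegrE ?hnorm_ge0 ?ltW // sqr_hnorm_dsum big_ord1 !ffunE.
by rewrite ltr_sqr ?nnegrE ?hnorm_ge0 ?ltW.
Qed.

(** A free family is extracted greedily from [s], so that a strong neighbourhood given by arbitrary
    vectors contains one given by free vectors, to which [fold_transitive_all] applies. A vector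
    outside the current span joins the family; one inside it only tightens the tolerance. *)
Lemma finite_control (s : seq H) (e : R) : 0 < e ->
  exists n (X : 'I_n -> H) (d : R), [/\ free_family X, 0 < d &
    forall D : H -> H, linear D -> (forall i, hnorm dot (D (X i)) < d) ->
      forall x, x \in s -> hnorm dot (D x) < e].
Proof.
move=> e0; elim: s => [|x s [n [X [d [frX d0 hX]]]]].
  exists 0%N, (fun=> 0), 1; split=> //.
  by move=> c _ [].
have [[c xc]|nx] := pselect (in_span X x).
  (* The [+ 1] keeps [C] positive when all coefficients vanish, and makes the estimate strict. *)
  pose C := \sum_i normc (c i) + 1.
  have C0 : 0 < C by rewrite ltr_wpDl // sumr_ge0 // => i _; apply: normc_ge0.
  exists n, X, (Num.min d (e / C)); split=> //.
    by rewrite lt_min d0 divr_gt0.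
  move=> D linD hD y; rewrite inE => /orP[/eqP->|ys].
    rewrite xc (lin_sum linD); apply: le_lt_trans (hnorm_sum _ _) _.
    apply: (@le_lt_trans _ _ (\sum_i normc (c i) * (e / C))).
      apply: ler_sum => i _; rewrite (lin_Z linD) hnormZ.
      apply: ler_wpM2l; first exact: normc_ge0.
      by have := hD i; rewrite lt_min => /andP[_ /ltW].
    rewrite -mulr_suml mulrA ltr_pdivrMr // mulrC ltr_pM2l // /C; lra.
  apply: hX => // i; by have := hD i; rewrite lt_min => /andP[].
exists n.+1, (cons_family x X), (Num.min d e); split.
- exact: free_family_cons.
- by rewrite lt_min d0.
move=> D linD hD y; rewrite inE => /orP[/eqP->|ys].
  by have := hD ord0; rewrite /cons_family unlift_none lt_min => /andP[].
apply: hX => // i; have := hD (lift ord0 i).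
by rewrite /cons_family liftK lt_min => /andP[].
Qed.

Lemma simultaneous_approximation B (s : seq H) (e : R) : linear B -> 0 < e ->
  exists2 T, A T & forall x, x \in s -> hnorm dot (B x - T x) < e.
Proof.
move=> linB e0; have [n [X [d [frX d0 hX]]]] := finite_control s e0.
have : orbit_closure X (app B X) by rewrite fold_transitive_all.
move=> /(_ d d0)[T AT hT]; exists T => //.
apply: (hX (fun x => B x - T x)).
  by move=> a u v; rewrite linB (A_lin AT) scalerBr opprD addrACA.
move=> i; apply: le_lt_trans hT.
by have := hnorm_coord dot (app B X - app T X) i; rewrite !ffunE.
Qed.

End Transitivity.

Unset Implicit Arguments.

Theorem theorem3p1 (R : realType) (H : completeNormedModType R[i])
  (dot : {dot H for (@Num.conj R[i])}) (hdot : dot_induces_norm dot)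
  (M A : set (H -> H)) :
  finite_von_neumann_algebra dot M ->
  transitive_algebra A ->
  commutant M `<=` A ->
  two_fold_transitive A ->
  strongly_dense A.
Proof.
move=> finM trA MA two B [linB _].
(* [F] is generated by the traces on [A] of the basic strong neighbourhoods of [B]. It converges
   pointwise to [B], so every neighbourhood of [B] contains a generator, and generators are nonempty
   by simultaneous approximation. *)
pose F := filter_from [set p : seq H * R | 0 < p.2]
  (fun p => [set T | A T /\ forall x, x \in p.1 -> hnorm dot (B x - T x) < p.2]).
have FF : Filter F.
  apply: filter_from_filter; first by exists ([::], 1) => /=.
  move=> [s d] [t e] /= d0 e0; exists (s ++ t, Num.min d e) => /=.
    by rewrite lt_min d0.
  move=> T [AT hT]; split; split=> // x xs.
    by have := hT x; rewrite mem_cat xs lt_min => /(_ isT)/andP[].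
  by have := hT x; rewrite mem_cat xs orbT lt_min => /(_ isT)/andP[].
have FB : {ptws, F --> B}.
  apply/pointwise_cvgP => x; apply/cvgrPdist_lt => _ /gt0_real_complex[e e0 ->].
  exists ([:: x], e) => //= T [_ hT] /=.
  by rewrite (normr_hnorm hdot) ltcR; apply: hT; rewrite inE.
move=> U /FB[[s e] /= e0 sU].
have [T AT hT] := simultaneous_approximation hdot trA two finM MA s linB e0.
by exists T; split=> //; apply: sU.
Qed.
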